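(* Let $\mathcal{M}$ be the set of all operators $T\in\mathcal{L}(L_1(\Omega))$ such that for every $\varepsilon>0$ and every $A\in\Sigma^{+}$ there is a $B\in\Sigma_A^{+}$ with $\mu(B)<\infty$ and $$\left\|\chi_B\cdot T\left(\frac{\chi_B}{\mu(B)}\right)\right\|<\varepsilon .$$ Then: (1) if $\mathcal{N}\subset\mathcal{L}(L_1(\Omega))$ is a linear subspace such that every $T\in\mathcal{N}$ satisfies $\|Id_A+T_A\|=1+\|T_A\|$ for every $A\in\Sigma^{+}$, then $\mathcal{N}\subset\mathcal{M}$; (2) $\mathcal{M}$ is itself a closed linear subspace of $\mathcal{L}(L_1(\Omega))$ (closed in the operator norm), and every $T\in\mathcal{M}$ satisfies $\|Id_A+T_A\|=1+\|T_A\|$ for every $A\in\Sigma^{+}$.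
   Context: $(\Omega,\Sigma,\mu)$ is an arbitrary measure space in which every measurable set of positive measure contains a measurable subset of finite positive measure (atoms of finite measure are allowed). $L_1(\Omega)$ is the real Banach space of (classes of) $\mu$-integrable functions on $\Omega$ with its usual norm $\|\cdot\|$, and $\mathcal{L}(L_1(\Omega))$ is the space of all bounded linear operators on $L_1(\Omega)$ with the operator norm. $\Sigma^{+}=\{A\in\Sigma:\mu(A)>0\}$, and for $A\in\Sigma^{+}$, $\Sigma_A^{+}=\{B\in\Sigma^{+}: B\subset A\}$. For $A\in\Sigma^{+}$, $L_1(A)\subset L_1(\Omega)$ is the subspace of functions supported on $A$; $T_A:L_1(A)\to L_1(\Omega)$ is the restriction of $T$ to $L_1(A)$; $Id_A:L_1(A)\to L_1(\Omega)$ is the restriction of the identity (the inclusion map). The norms $\|Id_A+T_A\|$ and $\|T_A\|$ are operator norms of maps $L_1(A)\to L_1(\Omega)$. $\chi_B$ is the indicator function of $B$. *)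

(* Defs.v *)
From HB Require Import structures.
From mathcomp Require Import all_boot all_order all_algebra.
From mathcomp Require Import all_classical all_reals all_analysis.
From mathcomp Require Import ess_sup_inf measurable_realfun.

Set Implicit Arguments.
Unset Strict Implicit.
Unset Printing Implicit Defensive.

Import Order.TTheory GRing.Theory Num.Theory.
Import numFieldNormedType.Exports.
Local Open Scope classical_set_scope.
Local Open Scope ring_scope.
Local Open Scope quotient_scope.

(* The library's [LspaceType mu p1] (classes modulo a.e. equality of measurable
   functions with finite p-norm) carries no algebraic structure; this section
   makes it a normed module. The operations are those of representatives, and
   [Lrepr F] is the representative to which [F] coerces as a function. *)
Section Lspace_normed.
Context d (T : measurableType d) (R : realType).
Variables (mu : {measure set T -> \bar R}) (p : \bar R) (p1 : (1 <= p)%E).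

Notation Lfun := (LfunType mu p1).
Notation Lspace := (LspaceType mu p1).
Notation mfun_mu := {mfun_ mu, T >-> measurableTypeR R}.
Implicit Types (f g : Lfun) (F G H : Lspace).

Lemma LspaceP F : (F : T -> R) \in hoelder.Lfun mu p.
Proof.
apply/andP; split; rewrite inE /=; last exact: Lebesgue_finite.
exact: (measurable_funPT (repr (F : mfun_mu))).
Qed.

Definition Lrepr F : Lfun := Lfun_Sub p1 (LspaceP F).

Lemma mfunR_subproof f : (f : T -> measurableTypeR R) \in mfun.
Proof.
rewrite inE => mT Y mY; have h := measurable_funPT f mT Y.
by apply: h; exact: mY.
Qed.

Definition mfunR f : {mfun T >-> measurableTypeR R} := mfun_Sub (mfunR_subproof f).

Definition mfun_class f : mfun_mu := \pi_mfun_mu (mfunR f).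

Lemma mfun_classK f : (mfun_class f : T -> R) = f %[ae mu].
Proof.
have /eqmodP/asboolP : \pi_mfun_mu (repr (mfun_class f)) = \pi_mfun_mu (mfunR f).
  by rewrite reprK.
by [].
Qed.

Lemma mfunRE (h : {mfun T >-> measurableTypeR R}) :
  @measurable_fun _ _ T R setT (h : T -> R).
Proof. move=> mT Y mY; have h' := measurable_funPT h mT Y; by apply: h'; exact: mY. Qed.

Lemma ae_eq_Lnorm (f g : T -> R) :
  measurable_fun setT f -> measurable_fun setT g ->
  f = g %[ae mu] -> 'N[mu]_p[EFin \o f]%E = 'N[mu]_p[EFin \o g]%E.
Proof.
move=> mf mg fg; rewrite unlock; case: p p1 => [r r1||] //=.
- have mN (h : T -> R) : measurable_fun setT h ->
      @measurable_fun _ _ T (\bar R) setT (fun x => `|(h x)%:E| `^ r)%E.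
    move=> mh; apply: (measurableT_comp (measurable_poweR r)).
    by apply: measurableT_comp => //; exact/measurable_EFinP.
  congr (_ `^ _)%E; apply: ge0_ae_eq_integral => //.
  + exact: mN.
  + exact: mN.
  + by apply: filterS fg => x /(_ I) /= ->.
- move=> _; case: ifP => // _; apply: eq_ess_sup.
  by apply: filterS fg => x /(_ I) /= ->.
Qed.

Lemma mfun_class_finite f : finite_norm mu p (mfun_class f).
Proof.
rewrite /finite_norm (@ae_eq_Lnorm _ f) //; first exact: Lfunction_finite.
- exact: mfunRE.
- exact: mfun_classK.
Qed.

Definition Lclass f : Lspace := HB.pack_for Lspace (mfun_class f)
  (@isFinLebesgue.Build _ _ _ mu p p1 (mfun_class f) (mfun_class_finite f)).

Lemma Lspace_inj F G : (F : mfun_mu) = G -> F = G.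
Proof.
case: F G => [F [[hF]]] [G [[hG]]] /= FG; move: hG; rewrite -FG => hG.
by rewrite (Prop_irrelevance hF hG).
Qed.

Lemma LclassK f : (Lrepr (Lclass f) : T -> R) = f %[ae mu].
Proof. exact: mfun_classK. Qed.

Lemma Lspace_eqP F G : F = G <-> (Lrepr F : T -> R) = Lrepr G %[ae mu].
Proof.
split=> [->|FG]; first exact: nearW.
apply: Lspace_inj.
rewrite -[LHS](@reprK _ mfun_mu) -[RHS](@reprK _ mfun_mu).
by apply/eqmodP/asboolP.
Qed.

Lemma LreprK F : Lclass (Lrepr F) = F.
Proof. by apply/Lspace_eqP; exact: LclassK. Qed.

HB.instance Definition _ := gen_eqMixin Lspace.
HB.instance Definition _ := gen_choiceMixin Lspace.

Let add F G : Lspace := Lclass (Lrepr F + Lrepr G).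
Let opp F : Lspace := Lclass (- Lrepr F).
Let zero : Lspace := Lclass 0.
Let scale (a : R) F : Lspace := Lclass (a *: Lrepr F).

Lemma Lclass_eq f g : (f : T -> R) = g %[ae mu] -> Lclass f = Lclass g.
Proof.
move=> fg; apply/Lspace_eqP.
apply: ae_eq_trans (LclassK f) _; apply: ae_eq_trans fg _.
exact/ae_eq_sym/LclassK.
Qed.

Let addE f g : add (Lclass f) (Lclass g) = Lclass (f + g).
Proof.
apply: Lclass_eq; apply: filterS2 (LclassK f) (LclassK g) => x fx gx xT.
by congr (_ + _); [exact: fx|exact: gx].
Qed.

Let oppE f : opp (Lclass f) = Lclass (- f).
Proof.
apply: Lclass_eq; apply: filterS (LclassK f) => x fx xT.
by congr (- _); exact: fx.
Qed.

Let scaleE a f : scale a (Lclass f) = Lclass (a *: f).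
Proof.
apply: Lclass_eq; apply: filterS (LclassK f) => x fx xT.
by congr (a * _); exact: fx.
Qed.

Let addA : associative add.
Proof.
by move=> F G H; rewrite -(LreprK F) -(LreprK G) -(LreprK H) !addE addrA.
Qed.

Let addC : commutative add.
Proof. by move=> F G; rewrite -(LreprK F) -(LreprK G) !addE addrC. Qed.

Let add0 : left_id zero add.
Proof. by move=> F; rewrite -(LreprK F) addE add0r. Qed.

Let addN : left_inverse zero opp add.
Proof. by move=> F; rewrite -(LreprK F) oppE addE addNr. Qed.

HB.instance Definition _ := GRing.isZmodule.Build Lspace addA addC add0 addN.

Let scaleA a b F : scale a (scale b F) = scale (a * b) F.
Proof. by rewrite -(LreprK F) !scaleE scalerA. Qed.

Let scale1 : left_id 1 scale.
Proof. by move=> F; rewrite -(LreprK F) scaleE scale1r. Qed.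

Let scaleDr : right_distributive scale +%R.
Proof.
move=> a F G; rewrite -(LreprK F) -(LreprK G).
by rewrite [X in scale a X]addE !scaleE [RHS]addE scalerDr.
Qed.

Let scaleDl F : {morph scale^~ F : a b / a + b}.
Proof.
by move=> a b; rewrite -(LreprK F) !scaleE [RHS]addE scalerDl.
Qed.

HB.instance Definition _ := GRing.Zmodule_isLmodule.Build R Lspace
  scaleA scale1 scaleDr scaleDl.

Lemma LclassD f g : Lclass (f + g) = Lclass f + Lclass g.
Proof. by rewrite -addE. Qed.

Lemma LclassZ a f : Lclass (a *: f) = a *: Lclass f.
Proof. by rewrite -scaleE. Qed.

Lemma LspaceD F G : (F + G : T -> R) = (fun x => F x + G x) %[ae mu].
Proof. exact: LclassK. Qed.

Lemma LspaceZ a F : (a *: F : T -> R) = (fun x => a * F x) %[ae mu].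
Proof. exact: LclassK. Qed.

Definition Lspace_norm F : R := fine ('N[mu]_p[EFin \o (F : T -> R)])%E.

Lemma Lspace_norm_class f : Lspace_norm (Lclass f) = fine ('N[mu]_p[EFin \o f])%E.
Proof.
congr fine; apply: ae_eq_Lnorm; first exact: mfunRE.
- exact: measurable_funPT.
- exact: LclassK.
Qed.

Let normD F G : Lspace_norm (F + G) <= Lspace_norm F + Lspace_norm G.
Proof.
rewrite -(LreprK F) -(LreprK G) -LclassD !Lspace_norm_class.
exact: ler_LnormD.
Qed.

Let normZ a F : Lspace_norm (a *: F) = `|a| * Lspace_norm F.
Proof.
rewrite -(LreprK F) -LclassZ !Lspace_norm_class.
have -> : (EFin \o (a *: Lrepr F : T -> R) = EFin \o (a \*: Lrepr F))%E by [].
by rewrite LnormZ fineM// -finite_norm_fine.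
Qed.

Let norm0_eq0 F : Lspace_norm F = 0 -> F = 0.
Proof.
rewrite -(LreprK F) Lspace_norm_class => /fine_Lnormr_eq0 f0.
exact: Lclass_eq.
Qed.

HB.instance Definition _ := Lmodule_isNormed.Build R Lspace normD normZ norm0_eq0.

Lemma Lspace_normE F : `|F| = fine ('N[mu]_p[EFin \o (F : T -> R)])%E.
Proof. by []. Qed.

End Lspace_normed.

(* Bounded linear operators, with the pointwise operations and the operator
   norm. *)
Section bounded_operators.
Context (R : realType) (V W : normedModType R).

Definition bounded_linear : {pred V -> W} := fun f =>
  `[< linear f /\ exists M : R, forall x, `|f x| <= M * `|x| >].

Record bop := Bop { bop_fun :> V -> W; bopP : bop_fun \in bounded_linear }.

HB.instance Definition _ := [isSub of bop for bop_fun].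
HB.instance Definition _ := [Choice of bop by <:].

Lemma bounded_linear_submod_closed : submod_closed bounded_linear.
Proof.
split.
  apply/asboolP; split; first by move=> a x y; rewrite scaler0 addr0.
  by exists 0 => x; rewrite mul0r normr0.
move=> a f g /asboolP[lf [M fM]] /asboolP[lg [N gN]]; apply/asboolP; split.
  move=> b x y /=.
  rewrite !fctE lf lg !scalerDr !scalerA [in a * b]mulrC !addrA; congr (_ + _).
  by rewrite -!addrA; congr (_ + _); rewrite addrC.
exists (`|a| * M + N) => x.
rewrite (le_trans (ler_normD _ _))// mulrDl lerD// ?normrZ -?mulrA//.
by rewrite ler_wpM2l.
Qed.

HB.instance Definition _ := GRing.isSubmodClosed.Build _ _ bounded_linear
  bounded_linear_submod_closed.
HB.instance Definition _ := [SubChoice_isSubLmodule of bop by <:].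

Definition bop_linear (f : bop) : linear f := (asboolW (bopP f)).1.
HB.instance Definition _ (f : bop) :=
  GRing.isLinear.Build R V W *:%R (f : V -> W) (bop_linear f).

Definition opnorm (f : bop) : R :=
  sup [set `|f x| | x in [set x : V | `|x| <= 1]].

Let has_sup_opnorm (f : bop) :
  has_sup [set `|f x| | x in [set x : V | `|x| <= 1]].
Proof.
split; first by exists `|f 0|, 0 => //=; rewrite normr0.
have [_ [M fM]] := asboolW (bopP f).
exists `|M| => _ [x x1 <-]; rewrite (le_trans (fM x))//.
rewrite (le_trans (ler_norm _))// normrM normr_id ler_piMr//.
Qed.

Lemma le_opnorm (f : bop) x : `|f x| <= opnorm f * `|x|.
Proof.
have [->|x0] := eqVneq x 0; first by rewrite linear0 !normr0 mulr0.
have x_gt0 : 0 < `|x| by rewrite normr_gt0.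
rewrite -ler_pdivrMr//.
have -> : `|f x| / `|x| = `|f (`|x|^-1 *: x)|.
  by rewrite linearZ normrZ ger0_norm ?invr_ge0// mulrC.
apply: ub_le_sup; first exact: (has_sup_opnorm f).2.
exists (`|x|^-1 *: x) => //=.
by rewrite normrZ ger0_norm ?invr_ge0// mulVf// normr_eq0.
Qed.

Lemma opnorm_le (f : bop) M : (forall x, `|x| <= 1 -> `|f x| <= M) ->
  opnorm f <= M.
Proof.
move=> fM; apply: ge_sup; first exact: (has_sup_opnorm f).1.
by move=> _ [x x1 <-]; exact: fM.
Qed.

Lemma opnorm_ge0 (f : bop) : 0 <= opnorm f.
Proof.
apply: ub_le_sup; first exact: (has_sup_opnorm f).2.
by exists 0; rewrite /= ?linear0 normr0.
Qed.

Let opnormD (f g : bop) : opnorm (f + g) <= opnorm f + opnorm g.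
Proof.
apply: opnorm_le => x x1; rewrite (le_trans (ler_normD _ _))// lerD//.
- by rewrite (le_trans (le_opnorm f x))// ler_piMr// opnorm_ge0.
- by rewrite (le_trans (le_opnorm g x))// ler_piMr// opnorm_ge0.
Qed.

Let opnormZ_le a (f : bop) : opnorm (a *: f) <= `|a| * opnorm f.
Proof.
apply: opnorm_le => x x1; rewrite [X in X <= _]normrZ ler_wpM2l//.
by rewrite (le_trans (le_opnorm f x))// ler_piMr// opnorm_ge0.
Qed.

Let opnormZ a (f : bop) : opnorm (a *: f) = `|a| * opnorm f.
Proof.
apply/eqP; rewrite eq_le opnormZ_le/=.
have [->|a0] := eqVneq a 0; first by rewrite normr0 mul0r opnorm_ge0.
rewrite -ler_pdivlMl ?normr_gt0// -normfV.
by rewrite -[X in opnorm X <= _](scalerK a0 f) opnormZ_le.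
Qed.

Let opnorm0_eq0 (f : bop) : opnorm f = 0 -> f = 0.
Proof.
move=> f0; apply/val_inj/funext => x; apply/eqP; rewrite -normr_le0.
by have := le_opnorm f x; rewrite f0 mul0r.
Qed.

HB.instance Definition _ :=
  Lmodule_isNormed.Build R bop opnormD opnormZ opnorm0_eq0.

Lemma bop_normE (f : bop) :
  `|f| = sup [set `|f x| | x in [set x : V | `|x| <= 1]].
Proof. by []. Qed.

Lemma bopDE (f g : bop) x : (f + g) x = f x + g x. Proof. by []. Qed.

Lemma bopZE a (f : bop) x : (a *: f) x = a *: f x. Proof. by []. Qed.

End bounded_operators.

Notation L1 mu := (LspaceType1 mu).
Notation Lop mu := (bop (L1 mu) (L1 mu)).

Section L1.
Context d (T : measurableType d) (R : realType).
Variable mu : {measure set T -> \bar R}.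

Local Notation L1 := (L1 mu).

(* Junk value 0 when [h] is not measurable and integrable. *)
Definition L1class (h : T -> R) : L1 := Lclass (insubd 0 h).

Lemma L1classE (h : T -> R) : h \in Lfun mu 1 -> (L1class h : T -> R) = h %[ae mu].
Proof.
move=> hL; have := LclassK (insubd (0 : LfunType mu (lexx 1%E)) h).
apply: filterS => x /(_ I) hx _; rewrite [LHS]hx.
by have -> : (insubd (0 : LfunType mu (lexx 1%E)) h : T -> R) = h by exact: insubdK.
Qed.

Definition L1chi_mul (B : set T) (F : L1) : L1 :=
  L1class (fun x => \1_B x * (F : T -> R) x).

Definition Sigma_pos (A : set T) := measurable A /\ (0 < mu A)%E.

Section L1_on.
Variable A : set T.

Definition supported_on : {pred L1} := fun F =>
  `[< \forall x \ae mu, ~ A x -> (F : T -> R) x = 0 >].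

(* The subspace of functions supported on [A], with the norm inherited from
   L1. *)
Record L1_on := L1On { L1_val : L1; L1_onP : L1_val \in supported_on }.

HB.instance Definition _ := [isSub of L1_on for L1_val].
HB.instance Definition _ := [Choice of L1_on by <:].

Lemma supported_on_submod_closed : submod_closed supported_on.
Proof.
split.
  apply/asboolP; apply: filterS (LclassK (0 : LfunType mu (lexx 1%E))) => x.
  by move=> /(_ I) x0 _; exact: x0.
move=> a F G /asboolP F0 /asboolP G0; apply/asboolP.
apply: filterS2 (filterI F0 G0) (filterI (LspaceZ a F) (LspaceD (a *: F) G)).
move=> x [Fx Gx] [/(_ I) Zx /(_ I) Dx] Ax.
by rewrite Dx Zx Fx// Gx// mulr0 addr0.
Qed.

HB.instance Definition _ := GRing.isSubmodClosed.Build _ _ supported_on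
  supported_on_submod_closed.
HB.instance Definition _ := [SubChoice_isSubLmodule of L1_on by <:].

Lemma L1_val_linear : linear L1_val. Proof. by []. Qed.
HB.instance Definition _ :=
  GRing.isLinear.Build R L1_on L1 *:%R L1_val L1_val_linear.

Let L1_on_normD (F G : L1_on) :
  `|L1_val (F + G)| <= `|L1_val F| + `|L1_val G|.
Proof. by rewrite raddfD; exact: ler_normD. Qed.

Let L1_on_normZ a (F : L1_on) : `|L1_val (a *: F)| = `|a| * `|L1_val F|.
Proof. by rewrite linearZ normrZ. Qed.

Let L1_on_norm0 (F : L1_on) : `|L1_val F| = 0 -> F = 0.
Proof. by move=> /eqP; rewrite normr_eq0 => /eqP F0; exact: val_inj. Qed.

HB.instance Definition _ :=
  Lmodule_isNormed.Build R L1_on L1_on_normD L1_on_normZ L1_on_norm0.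

Lemma L1_on_normE (F : L1_on) : `|F| = `|L1_val F|. Proof. by []. Qed.

Lemma L1_val_bounded : L1_val \in @bounded_linear R L1_on L1.
Proof.
apply/asboolP; split; first exact: linearP.
by exists 1 => F; rewrite mul1r.
Qed.

Definition Id_on : bop L1_on L1 := Bop L1_val_bounded.

Lemma op_on_bounded (S : bop L1 L1) :
  (fun F : L1_on => S (L1_val F)) \in @bounded_linear R L1_on L1.
Proof.
apply/asboolP; split; first by move=> a F G; rewrite !linearP.
by exists `|S|; move=> F; exact: le_opnorm.
Qed.

Definition op_on (S : bop L1 L1) : bop L1_on L1 := Bop (op_on_bounded S).

End L1_on.

Definition classM : set (Lop mu) := [set S |
  forall (e : R) (A : set T), 0 < e -> Sigma_pos A ->
  exists B, [/\ Sigma_pos B, B `<=` A, (mu B < +oo)%E &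
    `|L1chi_mul B (S (L1class (fun x => \1_B x / fine (mu B))))| < e]].

End L1.

Arguments classM {d T R} mu _.

(* Main.v *)
Require Import Defs.
From HB Require Import structures.
From mathcomp Require Import all_boot all_order all_algebra.
From mathcomp Require Import all_classical all_reals all_analysis.
From mathcomp Require Import measurable_realfun ring lra.
Import Order.TTheory GRing.Theory Num.Theory.
Import numFieldNormedType.Exports HBSimple.
Local Open Scope classical_set_scope.
Local Open Scope ring_scope.
Set Implicit Arguments.
Unset Strict Implicit.
Unset Printing Implicit Defensive.

(* If [c < |S_A|], then some [B] in [A] has [|S 1_C| > c mu C] for every [C] in
   [B]: the sets with [|S 1_C| <= c mu C] are stable under disjoint and increasing
   unions, so if they occurred inside every [B] they would exhaust [A].
   If [S] is in M, take [C] in such a [B] with [1_C S 1_C] small: then [1_C] and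
   [S 1_C] are almost disjoint while [|S 1_C|] is almost maximal, which gives the
   Daugavet equation on [A]; the same holds for [- S].
   Conversely, assume the Daugavet equation for [S] and [- S] and apply the first
   remark to [Id + S] and then to [Id - S]. It gives a [C] such that, for all [U]
   in [C] and with [f = S 1_U], both [|1_U + f|] and [|1_U - f|] almost equal
   [mu U + |f|]. Hence [f] is small on the part of [U] where [|f| < 1], and this
   part is almost all of [U]. This property of [S] puts [S] in M, and, passing to
   smaller sets, it is stable under sums. So M is the set of [S] such that [S] and
   [- S] satisfy the equation, and M is a linear space. *)

(** * Norms in L1, cutting by a measurable set, and classes of indicators *)

Section L1_facts.
Context d (T : measurableType d) (R : realType) (mu : {measure set T -> \bar R}).
Implicit Types (F G : L1 mu) (A B C U V W : set T).

Lemma L1_eq F G : (F : T -> R) = G %[ae mu] -> F = G.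
Proof. by move=> FG; exact/Lspace_eqP. Qed.

Lemma L1_integrable F : mu.-integrable setT (EFin \o (F : T -> R)).
Proof. by apply/Lfun1_integrable; exact: LspaceP. Qed.

Lemma L1_norm_ae F (h : T -> R) : measurable_fun setT h ->
  (fun x => `|(F : T -> R) x|) = h %[ae mu] -> `|F| = \int[mu]_x h x.
Proof.
move=> mh Fh; rewrite Lspace_normE Lnorm1 /Rintegral; congr fine.
apply: ae_eq_integral => //.
- have := measurable_int _ (L1_integrable F).
  by move=> /measurable_EFinP mF; exact/measurable_EFinP/measurableT_comp.
- exact/measurable_EFinP.
- by apply: filterS Fh => x /(_ I) Fx _ /=; rewrite -Fx.
Qed.

Lemma L1_measurable F : measurable_fun setT (F : T -> R).
Proof. by have /measurable_EFinP := measurable_int _ (L1_integrable F). Qed.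

Lemma L1_norm F : `|F| = \int[mu]_x `|(F : T -> R) x|.
Proof.
apply: L1_norm_ae; last exact: nearW.
by apply: measurableT_comp => //; exact: L1_measurable.
Qed.

Lemma L1_norm_integrable F :
  mu.-integrable setT (EFin \o (fun x => `|(F : T -> R) x|)).
Proof. exact: (integrable_norm (L1_integrable F)). Qed.

Lemma L1_add_ae F G : (F + G : T -> R) = (fun x => F x + G x) %[ae mu].
Proof. exact: LspaceD. Qed.

Lemma L1_sub_ae F G : (F - G : T -> R) = (fun x => F x - G x) %[ae mu].
Proof.
apply: filterS2 (LspaceD F (- G)) (LspaceZ (-1) G) => x /(_ I) e1 /(_ I) e2 _.
by rewrite e1 -scaleN1r e2 mulN1r.
Qed.

Lemma L1chi_Lfun B F : measurable B ->
  (fun x => \1_B x * (F : T -> R) x) \in Lfun mu 1.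
Proof.
move=> mB; apply/Lfun1_integrable; apply: le_integrable (L1_integrable F) => //.
  apply/measurable_EFinP/measurable_funM => //; exact: L1_measurable.
move=> x _ /=; rewrite lee_fin normrM indicE ler_piMl//.
by case: (_ \in _); rewrite ?normr1 ?normr0.
Qed.

Lemma L1chi_mulE B F : measurable B ->
  (L1chi_mul B F : T -> R) = (fun x => \1_B x * (F : T -> R) x) %[ae mu].
Proof. by move=> mB; exact/L1classE/L1chi_Lfun. Qed.

Lemma L1chi_mulD B F G : measurable B ->
  L1chi_mul B (F + G) = L1chi_mul B F + L1chi_mul B G.
Proof.
move=> mB; apply: L1_eq.
apply: filterS3 (L1chi_mulE (F + G) mB) (L1_add_ae F G)
  (filterI (L1_add_ae (L1chi_mul B F) (L1chi_mul B G))
    (filterI (L1chi_mulE F mB) (L1chi_mulE G mB))).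
move=> x /(_ I) e1 /(_ I) e2 [/(_ I) e3 [/(_ I) e4 /(_ I) e5]] _.
by rewrite e1 e2 e3 e4 e5 mulrDr.
Qed.

Lemma L1chi_mulZ B a F : measurable B ->
  L1chi_mul B (a *: F) = a *: L1chi_mul B F.
Proof.
move=> mB; apply: L1_eq.
apply: filterS3 (L1chi_mulE (a *: F) mB) (LspaceZ a F)
  (filterI (LspaceZ a (L1chi_mul B F)) (L1chi_mulE F mB)).
move=> x /(_ I) e1 /(_ I) e2 [/(_ I) e3 /(_ I) e4] _.
by rewrite e1 e2 e3 e4 mulrCA.
Qed.

Lemma L1chi_mulB B F G : measurable B ->
  L1chi_mul B (F - G) = L1chi_mul B F - L1chi_mul B G.
Proof. by move=> mB; rewrite L1chi_mulD// -scaleN1r L1chi_mulZ// scaleN1r. Qed.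

(** At almost every point one of the two pieces vanishes and the other equals [F], so the absolute
    values add up before integration. *)
Lemma L1_norm_split B F : measurable B ->
  `|F| = `|L1chi_mul B F| + `|F - L1chi_mul B F|.
Proof.
move=> mB; rewrite (L1_norm (L1chi_mul B F)) (L1_norm (F - _)) -RintegralD//;
  [|exact: L1_norm_integrable..].
apply: L1_norm_ae.
  by apply: measurable_funD; apply: measurableT_comp => //; exact: L1_measurable.
apply: filterS2 (L1_sub_ae F (L1chi_mul B F)) (L1chi_mulE F mB).
move=> x /(_ I) -> /(_ I) -> _; rewrite indicE.
case: (_ \in _); first by rewrite mul1r subrr normr0 addr0.
by rewrite mul0r subr0 normr0 add0r.
Qed.

Lemma L1chi_mul_norm B F : measurable B -> `|L1chi_mul B F| <= `|F|.
Proof. by move=> mB; rewrite (L1_norm_split F mB) lerDl. Qed.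

Lemma L1chi_mulI B C F : measurable B -> measurable C ->
  L1chi_mul (B `&` C) F = L1chi_mul B (L1chi_mul C F).
Proof.
move=> mB mC; apply: L1_eq.
apply: filterS3 (L1chi_mulE F (measurableI _ _ mB mC))
  (L1chi_mulE (L1chi_mul C F) mB) (L1chi_mulE F mC).
by move=> x /(_ I) -> /(_ I) -> /(_ I) -> _; rewrite indicI /= mulrA.
Qed.

(** Left unnormalised, unlike the functions in [classM], so as to be additive over disjoint sets;
    [L1class_scale_indic] links the two forms. *)
Definition L1indic U : L1 mu := L1class mu \1_U.

Section finite_set.
Variable U : set T.
Hypotheses (mU : measurable U) (Ufin : (mu U < +oo)%E).

Lemma indic_Lfun : \1_U \in Lfun mu 1.
Proof.
apply/Lfun1_integrable/integrableP; split; first exact/measurable_EFinP.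
under eq_integral do rewrite /= ger0_norm//.
by rewrite integral_indic// setIT.
Qed.

Lemma L1indicE : (L1indic U : T -> R) = \1_U %[ae mu].
Proof. exact/L1classE/indic_Lfun. Qed.

Lemma L1indic_norm : `|L1indic U| = fine (mu U).
Proof.
rewrite (@L1_norm_ae _ \1_U)//.
  by rewrite /Rintegral integral_indic// setIT.
by apply: filterS L1indicE => x /(_ I) -> _; rewrite ger0_norm.
Qed.

Lemma L1class_scale_indic (a : R) :
  L1class mu (fun x => \1_U x / a) = a^-1 *: L1indic U.
Proof.
have h : (fun x => \1_U x / a) \in Lfun mu 1.
  have -> : (fun x => \1_U x / a) = (a^-1 \o* \1_U) by apply/funext => x.
  by apply: Lfun_scale => //; exact: indic_Lfun.
apply: L1_eq; apply: filterS3 (L1classE h) (LspaceZ a^-1 (L1indic U)) L1indicE.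
by move=> x /(_ I) -> /(_ I) -> /(_ I) -> _; rewrite mulrC.
Qed.

Lemma L1chi_mul_indic : L1chi_mul U (L1indic U) = L1indic U.
Proof.
apply: L1_eq; apply: filterS2 (L1chi_mulE (L1indic U) mU) L1indicE.
move=> x /(_ I) -> /(_ I) -> _.
by rewrite indicE; case: (_ \in _); rewrite ?mulr1 ?mulr0.
Qed.

End finite_set.

Lemma L1indicU U V : measurable U -> measurable V ->
  (mu U < +oo)%E -> (mu V < +oo)%E -> U `&` V = set0 ->
  L1indic (U `|` V) = L1indic U + L1indic V.
Proof.
move=> mU mV Ufin Vfin UV0.
have fin : (mu (U `|` V) < +oo)%E by rewrite measureU// lte_add_pinfty.
apply: L1_eq; apply: filterS3 (L1indicE (measurableU _ _ mU mV) fin)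
  (L1_add_ae (L1indic U) (L1indic V)) (filterI (L1indicE mU Ufin) (L1indicE mV Vfin)).
move=> x /(_ I) -> /(_ I) -> [/(_ I) -> /(_ I) ->] _.
have : ~ (x \in U /\ x \in V).
  by rewrite !inE => xUV; suff : set0 x by []; rewrite -UV0.
by rewrite !indicE in_setU; case: (_ \in U); case: (_ \in V) => h;
  rewrite /= ?addr0 ?add0r//; case: h.
Qed.

(* Pointwise, [|1 + f| + |1 - f| - 2 |f|] is [2 (1 - |f|)] where [|f| < 1] and
   [0] elsewhere. *)
Lemma L1indic_norm_addsub U F : measurable U -> (mu U < +oo)%E ->
  let W := U `&` [set x | `|(F : T -> R) x| < 1] in
  measurable W /\
  `|L1indic U + F| + `|L1indic U - F| + 2 * `|L1chi_mul W F| =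
  2 * (`|F| + fine (mu W)).
Proof.
move=> mU Ufin W.
have mF := L1_measurable F.
have mnF : measurable_fun setT (fun x => `|(F : T -> R) x|).
  exact: measurableT_comp.
have mW : measurable W.
  apply: measurableI => //; rewrite -[X in measurable X]setTI.
  have -> : [set x | `|(F : T -> R) x| < 1] =
      (fun x => `|(F : T -> R) x|) @^-1` `]-oo, 1[.
    by apply/seteqP; split => x /=; rewrite in_itv.
  exact: mnF.
have Wfin : (mu W < +oo)%E
  by apply: le_lt_trans Ufin; apply: le_measure; rewrite ?inE//; exact: subIsetl.
split => //; rewrite -(L1indic_norm mW Wfin).
(* Each side is a sum of four norms. Pairing them with [s] turns each side into one integral, and
   the integrands are then compared pointwise. *)
pose s G H := fun x => `|(G : L1 mu) x| + `|(H : L1 mu) x| : R.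
have ms G H : measurable_fun setT (s G H).
  by apply: measurable_funD; apply: measurableT_comp => //; exact: L1_measurable.
have intS G H : mu.-integrable setT (EFin \o s G H).
  apply: (@integrableD _ _ _ mu setT measurableT (EFin \o _) (EFin \o _));
    exact: L1_norm_integrable.
have es G H : `|G| + `|H| = \int[mu]_x s G H x.
  by rewrite !L1_norm -RintegralD//; exact: L1_norm_integrable.
rewrite !mulr2n !mulrDl !mul1r [in RHS]addrACA 4!es.
rewrite -!RintegralD//; [|exact: intS..].
congr fine; apply: ae_eq_integral => //.
1,2: by apply/measurable_EFinP/measurable_funD; exact: ms.
apply: filterS3 (L1_add_ae (L1indic U) F) (L1_sub_ae (L1indic U) F)
  (filterI (L1chi_mulE F mW) (filterI (L1indicE mU Ufin) (L1indicE mW Wfin))).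
move=> x /(_ I) e1 /(_ I) e2 [/(_ I) e3 [/(_ I) e4 /(_ I) e5]] _.
rewrite /s e1 e2 e3 e4 e5 !indicE in_setI.
congr EFin; case: (_ \in U) => /=; last first.
  by rewrite add0r sub0r mul0r normrN normr0 !addr0.
have [xW|xW] := boolP (x \in _).
  move: xW; rewrite inE /= => xW; rewrite mul1r normr1.
  move: xW; rewrite ltr_norml => /andP[x1 x2].
  by rewrite (@ger0_norm _ (1 + _)) 1?(@ger0_norm _ (1 - _)); lra.
have : ~ (`|(F : T -> R) x| < 1) by move=> h; move/negP: xW; apply; rewrite inE.
move=> /negP; rewrite -leNgt ler_normr mul0r normr0 => /orP[h|h].
  by rewrite (@ger0_norm _ (1 + _)) 1?(@ler0_norm _ (1 - _)) 1?ger0_norm; lra.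
by rewrite (@ler0_norm _ (1 + _)) 1?(@ger0_norm _ (1 - _)) 1?ler0_norm; lra.
Qed.

End L1_facts.

Lemma bop_le (R : realType) (V W : normedModType R) (f : bop V W) (x : V) :
  `|f x| <= `|f| * `|x|.
Proof. exact: le_opnorm. Qed.

(** * Exhausting a set of finite measure *)

Section exhaustion.
Context d (T : measurableType d) (R : realType) (mu : {measure set T -> \bar R}).

(* Greedy choice: each step adjoins a disjoint member of [G] whose measure is at
   least half of the supremum of those available. *)
Lemma exhaustion (G : set (set T)) (P : set T) :
  measurable P -> (mu P < +oo)%E ->
  (forall C, G C -> measurable C /\ C `<=` P) ->
  (forall C, measurable C -> C `<=` P -> mu C = 0%E -> G C) ->
  (forall C D, G C -> G D -> C `&` D = set0 -> G (C `|` D)) ->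
  (forall U : (set T)^nat, {homo U : n m / (n <= m)%N >-> n `<=` m} ->
    (forall n, G (U n)) -> G (\bigcup_n U n)) ->
  (forall B, Sigma_pos mu B -> B `<=` P ->
    exists C, [/\ Sigma_pos mu C, C `<=` B & G C]) ->
  G P.
Proof.
move=> mP Pfin GP G0 GU Gcup Gex.
pose m B := fine (mu B).
have finP C : measurable C -> C `<=` P -> mu C = (m C)%:E.
  move=> mC CP; rewrite /m fineK// ge0_fin_numE//.
  by apply: le_lt_trans Pfin; apply: le_measure; rewrite ?inE.
have mGe C : G C -> mu C = (m C)%:E by move=> /GP[]; exact: finP.
have mG C : G C -> m C <= m P.
  move=> GC; have [mC CP] := GP _ GC; rewrite -lee_fin -!finP//.
  by apply: le_measure; rewrite ?inE.
have G00 : G set0 by apply: G0 => //; rewrite measure0.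
have step U : exists C, G C /\ (G U -> C `&` U = set0 /\
    forall C', G C' -> C' `&` U = set0 -> m C' <= 2 * m C).
  have [GUU|nGU] := pselect (G U); last by exists set0.
  pose E := m @` [set C | G C /\ C `&` U = set0].
  have supE : has_sup E.
    split; first by exists (m set0), set0 => //; split => //; exact: set0I.
    by exists (m P) => _ [C [GC _] <-]; exact: mG.
  have leE C' : G C' -> C' `&` U = set0 -> m C' <= sup E.
    by move=> GC' C'U; apply: ub_le_sup; [exact: supE.2|exists C'].
  (* If the supremum is not positive, all candidates are null and the empty set will do; otherwise
     some candidate exceeds half of the supremum. *)
  have [E0|E0] := leP (sup E) 0.
    exists set0; split => // _; split; first exact: set0I.
    by move=> C' GC' C'U; rewrite /m measure0 mulr0 (le_trans (leE _ _ _)).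
  have [_ [C [GC CU] <-]] := sup_adherent (divr_gt0 E0 (@ltr0n R 2)) supE.
  move=> ltC; exists C; split => // _; split => // C' GC' C'U.
  by rewrite (le_trans (leE _ _ _))//; lra.
have [f fP] := choice step.
pose U n := iter n (fun V => V `|` f V) set0.
have GUn n : G (U n).
  elim: n => [|n ih]; first exact: G00.
  have [Gf /(_ ih)[fU _]] := fP (U n).
  by rewrite /U iterS; apply: GU => //; rewrite setIC.
have mU n : m (U n.+1) = m (U n) + m (f (U n)).
  have [Gf /(_ (GUn n))[fU _]] := fP (U n).
  apply: EFin_inj; rewrite EFinD -!mGe// [U n.+1]/(_ `|` _) measureU//.
  - by have [] := GP _ (GUn n).
  - by have [] := GP _ Gf.
  - by rewrite setIC.
have ndU : {homo U : n m / (n <= m)%N >-> n `<=` m}.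
  apply: homo_leq => [|B A C AB BC|n]; [exact: subset_refl| |exact: subsetUl].
  exact: subset_trans AB BC.
set V := \bigcup_n U n.
have GV : G V by exact: Gcup.
have [mV VP] := GP _ GV.
have mPV : measurable (P `\` V) by exact: measurableD.
have VPV : V `&` (P `\` V) = set0 by rewrite setDE setICA setICr setI0.
have -> : P = V `|` (P `\` V) by rewrite setDUK.
have [PV0|PVn0] := eqVneq (mu (P `\` V)) 0%E.
  by apply: GU => //; apply: G0 => //; exact: subDsetl.
have PVpos : Sigma_pos mu (P `\` V) by split => //; rewrite lt0e PVn0/=.
have [C [Cpos CPV GC]] := Gex _ PVpos (@subDsetl _ P V).
have mC0 : 0 < m C by rewrite -lte_fin -mGe//; exact: Cpos.2.
(* [C] is disjoint from every [U n], so it is available at each step, and each step adjoins a set of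
   measure at least [m C / 2]. This contradicts the bound [m P] for large [n]. *)
have big n : n%:R * m C <= 2 * m (U n).
  elim: n => [|n ih].
    by rewrite mul0r mulr_ge0//; exact: fine_ge0.
  have [Gf /(_ (GUn n))[fU /(_ C GC)]] := fP (U n).
  have -> : C `&` U n = set0.
    rewrite -subset0 => x [/CPV[_ Vx] Ux]; apply: Vx.
    by exists n.
  by move=> /(_ erefl) lef; rewrite mU -natr1 mulrDl mul1r mulrDr lerD.
have := big (Num.truncn (2 * m P / m C)).+1.
have := truncnS_gt (2 * m P / m C).
rewrite ltr_pdivrMr// => h1 h2.
have := lt_le_trans h1 h2.
by rewrite ltr_pM2l// ltNge mG.
Qed.

End exhaustion.

(** * Localising the norm of a restricted operator *)

Section norm_localization.
Context d (T : measurableType d) (R : realType) (mu : {measure set T -> \bar R}).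
Variables (S : Lop mu) (c : R).

Let K (F : L1 mu) := `|S F| <= c * `|F|.

(** The norm of [F] is exactly additive over the two pieces, whereas that of [S F] is merely
    subadditive, which is the favourable direction. *)
Let K_split B F : measurable B ->
  K (L1chi_mul B F) -> K (F - L1chi_mul B F) -> K F.
Proof.
move=> mB K1 K2; rewrite /K -{1}[F](subrK (L1chi_mul B F)) linearD.
rewrite (le_trans (ler_normD _ _))// (L1_norm_split F mB) mulrDr addrC.
exact: lerD.
Qed.

Let indic_bound A := forall P, measurable P -> P `<=` A -> (mu P < +oo)%E ->
  K (L1indic mu P).

Let KZ a F : K F -> K (a *: F).
Proof. by move=> KF; rewrite /K linearZ !normrZ mulrCA ler_wpM2l. Qed.

Let K0 : K 0.
Proof. by rewrite /K linear0 !normr0 mulr0. Qed.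

(** [K_split] removes the level sets of [h] one value at a time; on each of them the function is a
    multiple of an indicator. *)
Let K_sfun A (h : {sfun T >-> R}) : measurable A -> indic_bound A ->
  mu.-integrable setT (EFin \o h) -> K (L1chi_mul A (L1class mu h)).
Proof.
move=> mA KA ih.
have hL : (h : T -> R) \in Lfun mu 1 by apply/Lfun1_integrable.
have mh (y : R) : measurable (h @^-1` [set y]).
  by rewrite -[X in measurable X]setTI; exact: measurable_funPT.
have hfin (y : R) : y != 0 -> (mu (h @^-1` [set y]) < +oo)%E.
  move=> y0; set B := h @^-1` _; have mB : measurable B by exact: mh.
  have /integrableP[_] : mu.-integrable setT (EFin \o (\1_B : T -> R)).
    have -> : (\1_B : T -> R) = y^-1 \o* (fun x => \1_B x * h x).
      apply/funext => x /=; rewrite indicE; case: (boolP (x \in B)) => [|_].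
        by rewrite inE => -> /=; rewrite mul1r mulfV.
      by rewrite !mul0r.
    apply/Lfun1_integrable/Lfun_scale => //; apply/Lfun1_integrable.
    apply: le_integrable ih => //.
      by apply/measurable_EFinP/measurable_funM => //; exact: measurable_funPT.
    move=> x _ /=; rewrite lee_fin normrM indicE ler_piMl//.
    by case: (_ \in _); rewrite ?normr1 ?normr0.
  under eq_integral do rewrite /= ger0_norm//.
  by rewrite integral_indic// setIT.
have indh y x : \1_(h @^-1` [set y]) x = (h x == y)%:R :> R.
  rewrite indicE; congr (nat_of_bool _)%:R.
  by apply/idP/eqP => [|xy]; rewrite inE.
have main (s : seq R) (F : L1 mu) : uniq s ->
    (F : T -> R) = (fun x => if h x \in s then \1_A x * h x else 0) %[ae mu] ->
    K F.
  elim: s F => [|y s ih'] F.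
    move=> _ F0; suff -> : F = 0 by [].
    rewrite -(scale0r F); apply: L1_eq.
    by apply: filterS2 F0 (LspaceZ 0 F) => x /(_ I) -> /(_ I) ->; rewrite mul0r.
  rewrite cons_uniq => /andP[ys us] FE.
  apply: (K_split (mh y)); last first.
    apply: ih' => //; apply: filterS3 FE (L1chi_mulE F (mh y))
      (L1_sub_ae F (L1chi_mul (h @^-1` [set y]) F)).
    move=> x /(_ I) e1 /(_ I) e2 /(_ I) e3 _; rewrite e3 e2 e1 in_cons indh.
    have [xy|xy] := eqVneq (h x) y; last by rewrite mul0r subr0.
    by rewrite mul1r subrr xy (negbTE ys).
  (* The zero level set may have infinite measure, but [F] vanishes on it. *)
  have [y0|y0] := eqVneq y 0.
    suff -> : L1chi_mul (h @^-1` [set y]) F = 0 by [].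
    rewrite -(scale0r F); apply: L1_eq.
    apply: filterS3 FE (L1chi_mulE F (mh y)) (LspaceZ 0 F).
    move=> x /(_ I) e1 /(_ I) e2 /(_ I) e3 _; rewrite e3 e2 e1 indh mul0r.
    have [xy|xy] := eqVneq (h x) y; last by rewrite mul0r.
    by rewrite xy in_cons eqxx/= y0 !mulr0.
  have mAy : measurable (A `&` h @^-1` [set y]) by exact: measurableI.
  have Ayfin : (mu (A `&` h @^-1` [set y]) < +oo)%E.
    apply: le_lt_trans (hfin _ y0).
    by apply: le_measure; rewrite ?inE//; exact: subIsetr.
  suff -> : L1chi_mul (h @^-1` [set y]) F = y *: L1indic mu (A `&` h @^-1` [set y]).
    by apply/KZ/KA => //; exact: subIsetl.
  apply: L1_eq.
  apply: filterS3 FE (L1chi_mulE F (mh y))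
    (filterI (LspaceZ y (L1indic mu (A `&` h @^-1` [set y]))) (L1indicE mAy Ayfin)).
  move=> x /(_ I) e1 /(_ I) e2 [/(_ I) e3 /(_ I) e4] _; rewrite e2 e3 e4 e1.
  rewrite indicI /= indh; have [xy|xy] := eqVneq (h x) y.
    by rewrite in_cons xy eqxx/= mul1r mulr1 mulrC.
  by rewrite mul0r !mulr0.
refine (main _ (L1chi_mul A (L1class mu h)) (finmap.fset_uniq (fset_set (range h))) _).
apply: filterS2 (L1chi_mulE (L1class mu h) mA) (L1classE hL).
move=> x /(_ I) -> /(_ I) -> _; rewrite in_fset_set; last exact: fimfunP.
by rewrite mem_set//; exists x.
Qed.

Let K_on A F : measurable A -> indic_bound A -> F \in supported_on A -> 0 <= c ->
  K F.
Proof.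
move=> mA KA FA c0.
have [g [ig _ g0]] := approximation_sfun_integrable measurableT (L1_integrable F).
have FE : L1chi_mul A F = F.
  have /asboolP FA' := FA.
  apply: L1_eq; apply: filterS2 (L1chi_mulE F mA) FA' => x /(_ I) -> Fx _.
  rewrite indicE; have [|] := boolP (x \in A); first by rewrite mul1r.
  by rewrite notin_setE => /Fx ->; rewrite mulr0.
have M0 : 0 < c + `|S| + 1 by rewrite ltr_wpDl// addr_ge0.
apply/ler_addgt0Pr => e e0.
(* Replacing [F] by an approximant within [r] costs [|S| * r] on the left and [c * r] on the right,
   in total at most [e]; the added 1 keeps the denominator positive. *)
pose r := e / (c + `|S| + 1).
have r0 : 0 < r by exact: divr_gt0.
have [n gn] : exists n, `|F - L1class mu (g n)| < r.
  have [_ /cvgr_lt/(_ _ r0)[n _ /(_ n (leqnn n)) /= gn]] := (fine_cvgP _ _).1 g0.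
  exists n; apply: le_lt_trans gn.
  rewrite (@L1_norm_ae _ _ _ _ _ (fun x => `|(F : T -> R) x - g n x|))//.
    apply: measurableT_comp => //; apply: measurable_funB => //.
    exact: L1_measurable.
  have gL : (g n : T -> R) \in Lfun mu 1 by apply/Lfun1_integrable.
  apply: filterS2 (L1_sub_ae F (L1class mu (g n))) (L1classE gL).
  by move=> x /(_ I) -> /(_ I) ->.
pose G := L1chi_mul A (L1class mu (g n)).
have FG : `|F - G| < r.
  apply: le_lt_trans gn; rewrite -{1}FE -L1chi_mulB//; exact: L1chi_mul_norm.
have KG : `|S G| <= c * `|G| by exact: K_sfun.
have SF : `|S F| <= `|S G| + `|S| * r.
  rewrite -{1}(subrK G F) linearD addrC (le_trans (ler_normD _ _))// lerD//.
  by rewrite (le_trans (bop_le S _))// ler_wpM2l// ltW.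
have GF : c * `|G| <= c * (`|F| + r).
  rewrite ler_wpM2l// -{1}(subrK F G) addrC (le_trans (ler_normD _ _))// lerD//.
  by rewrite distrC ltW.
have er : (c + `|S|) * r <= e.
  have -> : e = (c + `|S| + 1) * r by rewrite /r mulrC divfK// gt_eqF.
  by rewrite ler_wpM2r// ?lerDl// ltW.
rewrite (le_trans SF)// (le_trans (lerD KG (lexx _)))//.
by rewrite (le_trans (lerD GF (lexx _)))// mulrDr -addrA -mulrDl lerD.
Qed.

(* Otherwise [exhaustion] gives [`|S 1_P| <= c mu P] for all [P] in [A], and
   density of the simple functions extends this to all of L1(A). *)
Lemma norm_localization A :
  (forall A', Sigma_pos mu A' ->
    exists B, [/\ Sigma_pos mu B, B `<=` A' & (mu B < +oo)%E]) ->
  Sigma_pos mu A -> c < `|op_on A S| ->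
  exists B, [/\ Sigma_pos mu B, B `<=` A, (mu B < +oo)%E &
    forall C, Sigma_pos mu C -> C `<=` B ->
      c * fine (mu C) < `|S (L1indic mu C)|].
Proof.
move=> mu_fin Apos; rewrite ltNge => /negP cS; apply: contrapT => noB; apply: cS.
have small B : Sigma_pos mu B -> B `<=` A -> (mu B < +oo)%E ->
    exists C, [/\ Sigma_pos mu C, C `<=` B &
      `|S (L1indic mu C)| <= c * fine (mu C)].
  move=> Bpos BA Bfin; apply: contrapT => noC; apply: noB.
  exists B; split => // C Cpos CB; rewrite ltNge; apply/negP => SC.
  by apply: noC; exists C.
have c0 : 0 <= c.
  have [B [Bpos BA Bfin]] := mu_fin _ Apos.
  have [C [[mC C0] CB SC]] := small _ Bpos BA Bfin.
  have Cfin : (mu C < +oo)%E.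
    by apply: le_lt_trans Bfin; apply: le_measure; rewrite ?inE//; have [] := Bpos.
  have m0 : 0 < fine (mu C) by apply: fine_gt0; rewrite C0.
  by rewrite -(pmulr_lge0 _ m0) (le_trans _ SC).
have indA : indic_bound A.
  move=> P mP PA Pfin.
  have finP C : measurable C -> C `<=` P -> (mu C < +oo)%E.
    move=> mC CP.
    by apply: le_lt_trans Pfin; apply: le_measure; rewrite ?inE.
  have finPE C : measurable C -> C `<=` P -> mu C \is a fin_num.
    by move=> mC CP; rewrite ge0_fin_numE// finP.
  pose G C := [/\ measurable C, C `<=` P & K (L1indic mu C)].
  suff [] : G P by [].
  apply: (@exhaustion _ _ _ mu) => //.
  - by move=> C [].
  - move=> C mC CP C0; split => //.
    suff -> : L1indic mu C = 0 by [].
    by apply/eqP; rewrite -normr_eq0 L1indic_norm ?finP// C0.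
  - move=> C D [mC CP KC] [mD DP KD] CD; split; first exact: measurableU.
      by rewrite subUset.
    have Cfin := finP _ mC CP; have Dfin := finP _ mD DP.
    rewrite /K L1indicU// linearD (le_trans (ler_normD _ _))//.
    rewrite -L1indicU// L1indic_norm; [|exact: measurableU|]; last first.
      by rewrite measureU// lte_add_pinfty.
    rewrite measureU// fineD ?finPE// mulrDr lerD//.
    + by move: KC; rewrite /K L1indic_norm.
    + by move: KD; rewrite /K L1indic_norm.
  - move=> U ndU GU.
    have mU n : measurable (U n) by have [] := GU n.
    have UP n : U n `<=` P by have [] := GU n.
    have mV : measurable (\bigcup_n U n) by exact: bigcupT_measurable.
    have VP : \bigcup_n U n `<=` P by apply: bigcup_sub => n _.
    split => //; set V := \bigcup_n U n.
    have UV n : U n `<=` V by exact: bigcup_sup.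
    have mVU n : measurable (V `\` U n) by exact: measurableD.
    have VUP n : V `\` U n `<=` P by move=> x [/VP].
    have UVE n : U n `|` (V `\` U n) = V by rewrite setDUK.
    have UVI n : U n `&` (V `\` U n) = set0 by rewrite setDE setICA setICr setI0.
    have mVE n : fine (mu V) = fine (mu (U n)) + fine (mu (V `\` U n)).
      by rewrite -{1}(UVE n) measureU// fineD ?finPE.
    have cvU : fine (mu (U n)) @[n --> \oo] --> fine (mu V).
      have : (mu \o U) n @[n --> \oo] --> (fine (mu V))%:E.
        rewrite fineK ?finPE//; apply: nondecreasing_cvg_mu => //.
        by move=> n m nm; apply/subsetPset; exact: ndU.
      by move=> /fine_cvgP[].
    rewrite /K L1indic_norm ?finP//.
    apply/ler_addgt0Pr => e e0.
    (* Once the part of [V] outside [U n] has measure below this bound, [S] sends its indicator to a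
       function of norm at most [e]. *)
    have r0 : 0 < e / (`|S| + 1) by rewrite divr_gt0// ltr_wpDl.
    have := cvgr_gt _ cvU (fine (mu V) - e / (`|S| + 1)).
    rewrite ltrBlDr ltrDl => /(_ _ r0)[n _ /(_ n (leqnn n)) /= ltn].
    rewrite -{1}(UVE n) L1indicU ?finP// linearD (le_trans (ler_normD _ _))//.
    apply: lerD.
      have [_ _] := GU n; rewrite /K L1indic_norm ?finP// => /le_trans; apply.
      by rewrite ler_wpM2l// (mVE n) lerDl fine_ge0.
    rewrite (le_trans (bop_le S _))// L1indic_norm ?finP//.
    have le1 : fine (mu (V `\` U n)) <= e / (`|S| + 1).
      by move: ltn; rewrite (mVE n) => ltn; lra.
    have S1 : 0 < `|S| + 1 by rewrite ltr_wpDl.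
    rewrite (@le_trans _ _ ((`|S| + 1) * (e / (`|S| + 1))))//.
      by rewrite ler_pM// ?fine_ge0// lerDl.
    by rewrite mulrC divfK// gt_eqF.
  - move=> B Bpos BP.
    have [mB _] := Bpos.
    have [C [Cpos CB SC]] := small B Bpos (subset_trans BP PA) (finP _ mB BP).
    have [mC _] := Cpos.
    exists C; split => //; split => //; first exact: subset_trans BP.
    by rewrite /K L1indic_norm// finP//; exact: subset_trans BP.
apply: opnorm_le => -[F FA] /= F1.
rewrite (le_trans (K_on Apos.1 indA FA c0))// ler_piMr//.
Qed.

End norm_localization.

(** * The Daugavet equation, hereditary smallness and the class M *)

Section Daugavet.
Context d (T : measurableType d) (R : realType) (mu : {measure set T -> \bar R}).
Hypothesis mu_fin : forall A : set T, Sigma_pos mu A ->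
  exists B : set T, [/\ Sigma_pos mu B, B `<=` A & (mu B < +oo)%E].
Implicit Types (S : Lop mu) (A B C U W : set T).

Definition Daugavet S := forall A, Sigma_pos mu A ->
  `|Id_on mu A + op_on A S| = 1 + `|op_on A S|.

(* Unlike membership in [classM], this passes to smaller sets [C], so it can be
   achieved for two operators at once; it is therefore stable under sums. *)
Definition hereditarily_small S := forall (e : R) A, 0 < e -> Sigma_pos mu A ->
  exists C, [/\ Sigma_pos mu C, C `<=` A, (mu C < +oo)%E &
    forall U, Sigma_pos mu U -> U `<=` C ->
      exists W, [/\ measurable W, W `<=` U,
        fine (mu U) - fine (mu W) <= e * fine (mu U) &
        `|L1chi_mul W (S (L1indic mu U))| <= e * fine (mu U)]].

Let fin_sub B C : measurable B -> measurable C -> (mu C < +oo)%E ->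
  B `<=` C -> (mu B < +oo)%E.
Proof.
by move=> mB mC Cfin BC; apply: le_lt_trans Cfin; apply: le_measure; rewrite ?inE.
Qed.

Let fine_pos B : Sigma_pos mu B -> (mu B < +oo)%E -> 0 < fine (mu B).
Proof. by move=> [_ B0] Bfin; apply: fine_gt0; rewrite B0. Qed.

Lemma L1indic_supported A B : measurable B -> (mu B < +oo)%E -> B `<=` A ->
  L1indic mu B \in supported_on A.
Proof.
move=> mB Bfin BA; apply/asboolP; apply: filterS (L1indicE mB Bfin).
by move=> x /(_ I) -> Ax; rewrite indicE memNset// => /BA.
Qed.

Lemma op_on_indic S A B : measurable B -> (mu B < +oo)%E -> B `<=` A ->
  `|S (L1indic mu B)| <= `|op_on A S| * fine (mu B).
Proof.
move=> mB Bfin BA; rewrite -(L1indic_norm mB Bfin).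
exact: (bop_le (op_on A S) (L1On (L1indic_supported mB Bfin BA))).
Qed.

Lemma id_bounded : (@id (L1 mu)) \in @bounded_linear R (L1 mu) (L1 mu).
Proof. by apply/asboolP; split => //; exists 1 => F; rewrite mul1r. Qed.

Definition Idop : Lop mu := Bop id_bounded.

(** Makes [norm_localization] and [op_on_indic] applicable to the left side of the Daugavet
    equation. *)
Lemma Id_on_add A S : Id_on mu A + op_on A S = op_on A (Idop + S).
Proof. exact/val_inj. Qed.

Lemma L1indic_sub_norm W U : measurable W -> measurable U -> (mu U < +oo)%E ->
  W `<=` U -> `|L1indic mu U - L1indic mu W| = fine (mu U) - fine (mu W).
Proof.
move=> mW mU Ufin WU.
have Wfin := fin_sub mW mU Ufin WU.
have mD : measurable (U `\` W) by exact: measurableD.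
have Dfin : (mu (U `\` W) < +oo)%E by apply: (fin_sub mD mU Ufin); exact: subDsetl.
have WD : W `&` (U `\` W) = set0 by rewrite setDE setICA setICr setI0.
rewrite -{1 2}(setDUK WU) L1indicU// addrAC subrr add0r L1indic_norm//.
by rewrite measureU// fineD ?ge0_fin_numE// addrAC subrr add0r.
Qed.

Lemma classM_scaled S e A : classM mu S -> 0 < e -> Sigma_pos mu A ->
  exists B, [/\ Sigma_pos mu B, B `<=` A, (mu B < +oo)%E &
    `|L1chi_mul B (S (L1indic mu B))| < e * fine (mu B)].
Proof.
move=> MS e0 Apos; have [B [Bpos BA Bfin]] := MS e A e0 Apos.
have [mB _] := Bpos; have m0 := fine_pos Bpos Bfin.
rewrite L1class_scale_indic// linearZ L1chi_mulZ// normrZ.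
rewrite ger0_norm ?invr_ge0 ?ltW//.
by rewrite mulrC ltr_pdivrMr// => h; exists B.
Qed.

Lemma scaled_classM S : (forall e A, 0 < e -> Sigma_pos mu A ->
  exists B, [/\ Sigma_pos mu B, B `<=` A, (mu B < +oo)%E &
    `|L1chi_mul B (S (L1indic mu B))| < e * fine (mu B)]) -> classM mu S.
Proof.
move=> H e A e0 Apos; have [B [Bpos BA Bfin h]] := H e A e0 Apos.
have [mB _] := Bpos; have m0 := fine_pos Bpos Bfin.
exists B; split => //.
rewrite L1class_scale_indic// linearZ L1chi_mulZ// normrZ.
rewrite ger0_norm ?invr_ge0 ?ltW//.
by rewrite mulrC ltr_pdivrMr.
Qed.

Lemma classM_Daugavet S : classM mu S -> Daugavet S.
Proof.
move=> MS A Apos; rewrite Id_on_add; apply/eqP; rewrite eq_le; apply/andP; split.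
  apply: opnorm_le => -[F FA] /= F1.
  have F1' : `|F| <= 1 by [].
  apply: le_trans (ler_normD F (S F)) _; apply: lerD => //.
  rewrite (le_trans (bop_le (op_on A S) (L1On FA)))// ler_piMr//.
(* Three losses of [e / 4] (times the measure of [C]) will occur: one because [|S 1_C|] is only
   almost maximal, and two from the part of [S 1_C] on [C], which is discarded both on [C] and in
   comparing [S 1_C] with its part off [C]. *)
apply/ler_addgt0Pr => e e0; have e4 : 0 < e / 4 by lra.
have [|B [Bpos BA Bfin SB]] := @norm_localization _ _ _ _ S (`|op_on A S| - e / 4)
  A mu_fin Apos; first by lra.
have [C [Cpos CB _ SC]] := classM_scaled MS e4 Bpos.
have [mB _] := Bpos; have [mC _] := Cpos.
have CA := subset_trans CB BA.
have Cfin := fin_sub mC mB Bfin CB.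
have m0 := fine_pos Cpos Cfin.
have h1 := SB C Cpos CB.
have h2 := op_on_indic (Idop + S) mC Cfin CA.
set G := S (L1indic mu C) in SC h1.
have h3 : `|L1indic mu C + G| <= `|op_on A (Idop + S)| * fine (mu C) by exact: h2.
have h4 := L1_norm_split (L1indic mu C + G) mC.
have h5 := L1_norm_split G mC.
have E : L1indic mu C + G - L1chi_mul C (L1indic mu C + G) = G - L1chi_mul C G.
  by rewrite L1chi_mulD// L1chi_mul_indic// opprD addrACA subrr add0r.
rewrite E L1chi_mulD// L1chi_mul_indic// in h4.
have h6 : fine (mu C) <= `|L1indic mu C + L1chi_mul C G| + `|L1chi_mul C G|.
  rewrite -{1}(L1indic_norm mC Cfin).
  by rewrite -{1}(addrK (L1chi_mul C G) (L1indic mu C)) ler_normB.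
rewrite -(ler_pM2r m0) !mulrDl mul1r.
by have := mulr_gt0 e0 m0; rewrite mulrBl in h1; lra.
Qed.

Lemma Daugavet_hereditarily_small S :
  Daugavet S -> Daugavet (- S) -> hereditarily_small S.
Proof.
move=> DS DNS e A e0 Apos.
(* Localise [Idop + S'] at its norm on [A'] minus [e], which by the Daugavet equation is [1 - e]
   plus the norm of [S'] on [A']. The conclusion passes to subsets of [B], so it can be arranged for
   [S] and then for [- S] inside. *)
have loc S' A' : Daugavet S' -> Sigma_pos mu A' ->
    exists B, [/\ Sigma_pos mu B, B `<=` A', (mu B < +oo)%E &
    forall U, Sigma_pos mu U -> U `<=` B ->
      (1 - e) * fine (mu U) + `|S' (L1indic mu U)| <=
      `|L1indic mu U + S' (L1indic mu U)|].
  move=> DS' A'pos; have := DS' _ A'pos; rewrite Id_on_add => D.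
  have [|B [Bpos BA Bfin SB]] := @norm_localization _ _ _ _ (Idop + S')
    (`|op_on A' (Idop + S')| - e) A' mu_fin A'pos; first by lra.
  exists B; split => // U Upos UB; rewrite (le_trans _ (ltW (SB U Upos UB)))//.
  have [mB _] := Bpos; have [mU _] := Upos.
  have := op_on_indic S' mU (fin_sub mU mB Bfin UB) (subset_trans UB BA).
  by rewrite D; lra.
have [B [Bpos BA Bfin SB]] := loc S A DS Apos.
have [C [Cpos CB Cfin SC]] := loc (- S) B DNS Bpos.
exists C; split => //; first exact: subset_trans BA.
move=> U Upos UC; have [mU _] := Upos; have [mC _] := Cpos.
have Ufin := fin_sub mU mC Cfin UC.
set F := S (L1indic mu U).
have h1 : (1 - e) * fine (mu U) + `|F| <= `|L1indic mu U + F|.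
  by apply: SB => //; exact: subset_trans CB.
have h2 : (1 - e) * fine (mu U) + `|F| <= `|L1indic mu U - F|.
  by have := SC U Upos UC; rewrite -[(- S) _]/(- F) normrN.
(* Adding [h1] and [h2] and inserting this identity bounds the sum of [mu U - mu W] and [|1_W F|] by
   [e * mu U]. Both terms are non-negative, so each satisfies the bound. *)
have [mW h3] := L1indic_norm_addsub F mU Ufin.
set W := _ `&` _ in mW h3.
exists W; split => //; first exact: subIsetl.
  by have := normr_ge0 (L1chi_mul W F); lra.
have : fine (mu W) <= fine (mu U).
  have WU : W `<=` U by exact: subIsetl.
  apply: fine_le; rewrite ?ge0_fin_numE//; first exact: (fin_sub mW mU).
  by apply: le_measure; rewrite ?inE.
by lra.
Qed.

(** Take [U = C] and use the resulting [W] as the required set: replacing [1_C] by [1_W] under [S]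
    changes the norm by at most [|S|] times the small measure of [C] outside [W]. *)
Lemma hereditarily_small_classM S : hereditarily_small S -> classM mu S.
Proof.
move=> HS; apply: scaled_classM => e A e0 Apos.
have S1 : 0 < 1 + `|S| by rewrite ltr_pwDl.
(* The bound 1/2 gives [W] at least half the measure of [C], hence positive measure. The other bound
   makes the total error at most [e / 4 * mu C], so at most [e / 2 * mu W]. *)
pose r := Num.min (1 / 2) (e / (4 * (1 + `|S|))).
have r0 : 0 < r by rewrite lt_min !divr_gt0// mulr_gt0.
have r2 : r <= 1 / 2 by rewrite ge_min lexx.
have re : r * (1 + `|S|) <= e / 4.
  by rewrite -ler_pdivlMr// -mulrA -invfM ge_min lexx orbT.
have [C [Cpos CA Cfin HC]] := HS r A r0 Apos.
have [W [mW WC h1 h2]] := HC C Cpos (@subset_refl _ C).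
have [mC _] := Cpos; have m0 := fine_pos Cpos Cfin.
have Wfin := fin_sub mW mC Cfin WC.
have rm : r * fine (mu C) <= 1 / 2 * fine (mu C) by rewrite ler_wpM2r// ltW.
have W2 : fine (mu C) <= 2 * fine (mu W) by lra.
have Wpos : Sigma_pos mu W.
  split => //; rewrite lt0e measure_ge0 andbT; apply/eqP => W0.
  by move: W2; rewrite W0 /=; lra.
exists W; split => //; first exact: subset_trans CA.
have h3 : `|L1chi_mul W (S (L1indic mu C - L1indic mu W))| <=
    `|S| * (r * fine (mu C)).
  rewrite (le_trans (L1chi_mul_norm _ mW))// (le_trans (bop_le _ _))//.
  by rewrite ler_wpM2l// L1indic_sub_norm.
have h4 : `|L1chi_mul W (S (L1indic mu W))| <= r * (1 + `|S|) * fine (mu C).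
  have -> : S (L1indic mu W) = S (L1indic mu C) - S (L1indic mu C - L1indic mu W).
    by rewrite -linearB opprB addrC subrK.
  rewrite L1chi_mulB// (le_trans (ler_normB _ _))//.
  have -> : r * (1 + `|S|) * fine (mu C) =
    r * fine (mu C) + `|S| * (r * fine (mu C)) by ring.
  exact: lerD.
have h5 : r * (1 + `|S|) * fine (mu C) <= e / 4 * fine (mu C).
  by rewrite ler_wpM2r// ltW.
have eW : e / 4 * fine (mu C) <= e / 2 * fine (mu W).
  have -> : e / 2 * fine (mu W) = e / 4 * (2 * fine (mu W)) by field.
  by rewrite ler_wpM2l//; lra.
have : 0 < e / 2 * fine (mu W) by rewrite mulr_gt0 ?fine_pos//; lra.
by lra.
Qed.

Lemma hereditarily_smallZ a S : hereditarily_small S -> hereditarily_small (a *: S).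
Proof.
move=> HS e A e0 Apos.
have a1 : 0 < 1 + `|a| by rewrite ltr_pwDl.
(* This tolerance is at most [e], as the measure bound needs, and stays so after multiplication by
   [|a|], as the norm bound needs. *)
have r0 : 0 < e / (1 + `|a|) by exact: divr_gt0.
have re : e / (1 + `|a|) <= e by rewrite ler_pdivrMr// ler_peMr ?lerDl// ltW.
have are : `|a| * (e / (1 + `|a|)) <= e.
  by rewrite mulrCA ler_piMr ?(ltW e0)// ler_pdivrMr// mul1r lerDr.
have [C [Cpos CA Cfin HC]] := HS _ A r0 Apos.
exists C; split => // U Upos UC; have [W [mW WU h1 h2]] := HC U Upos UC.
have [mU _] := Upos; have [mC _] := Cpos.
have m0 := fine_pos Upos (fin_sub mU mC Cfin UC).
exists W; split => //; first by rewrite (le_trans h1)// ler_wpM2r// ltW.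
rewrite bopZE L1chi_mulZ// normrZ (le_trans (ler_wpM2l _ h2))//.
by rewrite mulrA ler_wpM2r// ltW.
Qed.

Lemma hereditarily_smallD S S' : hereditarily_small S -> hereditarily_small S' ->
  hereditarily_small (S + S').
Proof.
move=> HS HS' e A e0 Apos; have e2 : 0 < e / 2 by lra.
have [B [Bpos BA Bfin HB]] := HS _ A e2 Apos.
have [C [Cpos CB Cfin HC]] := HS' _ B e2 Bpos.
exists C; split => //; first exact: subset_trans BA.
move=> U Upos UC; have [mU _] := Upos; have [mC _] := Cpos.
have Ufin := fin_sub mU mC Cfin UC.
have [V [mV VU h1 h2]] := HB U Upos (subset_trans UC CB).
have [W [mW WU h3 h4]] := HC U Upos UC.
have mVW := measurableI _ _ mV mW.
(* The part of [V] outside [W] is disjoint from [W] and both lie in [U]; hence the measure of [U]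
   missed by the intersection is at most the sum of those missed by [V] and by [W]. *)
exists (V `&` W); split => //; first by move=> x [/VU].
  have VD : measurable (V `\` W) by exact: measurableD.
  have VDU : V `\` W `<=` U by move=> x [/VU].
  have e1 : fine (mu V) = fine (mu (V `\` W)) + fine (mu (V `&` W)).
    rewrite -fineD ?ge0_fin_numE//; first by rewrite -measureDI.
    - exact: (fin_sub VD mU).
    - by apply: (fin_sub mVW mU) => // x [/VU].
  have e4 : fine (mu (V `\` W)) + fine (mu W) <= fine (mu U).
    rewrite -fineD ?ge0_fin_numE//; [|exact: (fin_sub VD mU)|exact: (fin_sub mW mU)].
    rewrite -measureU//; last by rewrite setDE -setIA setICl setI0.
    have mVDW : measurable (V `\` W `|` W) by exact: measurableU.
    have VDWU : V `\` W `|` W `<=` U by rewrite subUset.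
    apply: fine_le; rewrite ?ge0_fin_numE//; first exact: (fin_sub mVDW mU).
    by apply: le_measure; rewrite ?inE.
  by lra.
rewrite bopDE L1chi_mulD// (le_trans (ler_normD _ _))//.
have h5 : `|L1chi_mul (V `&` W) (S (L1indic mu U))| <= e / 2 * fine (mu U).
  by rewrite setIC L1chi_mulI// (le_trans (L1chi_mul_norm _ mW)).
have h6 : `|L1chi_mul (V `&` W) (S' (L1indic mu U))| <= e / 2 * fine (mu U).
  by rewrite L1chi_mulI// (le_trans (L1chi_mul_norm _ mV)).
by lra.
Qed.

Lemma classMN S : classM mu S -> classM mu (- S).
Proof.
move=> MS e A e0 Apos; have [B [Bpos BA Bfin h]] := MS e A e0 Apos.
have [mB _] := Bpos; exists B; split => //.
rewrite -[(- S) _]/(- S _) -scaleN1r L1chi_mulZ// scaleN1r.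
by rewrite normrN.
Qed.

(** The Daugavet equation for both signs upgrades smallness on one subset to smallness inherited by
    all further subsets, which is what sums require. *)
Lemma classM_hereditarily_small S : classM mu S -> hereditarily_small S.
Proof.
move=> MS; apply: Daugavet_hereditarily_small; apply: classM_Daugavet => //.
exact: classMN.
Qed.

Lemma classM_submod_closed : submod_closed (mem (classM mu)).
Proof.
split.
  rewrite inE; apply: scaled_classM => e A e0 Apos.
  have [B [Bpos BA Bfin]] := mu_fin Apos.
  have [mB _] := Bpos; exists B; split => //.
  rewrite (_ : (0 : Lop mu) _ = 0)//.
  rewrite -(scale0r (0 : L1 mu)) L1chi_mulZ// scale0r normr0 mulr_gt0//.
  exact: fine_pos.
move=> a S S'; rewrite !inE => MS MS'; apply: hereditarily_small_classM.
apply: hereditarily_smallD; last exact: classM_hereditarily_small.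
exact/hereditarily_smallZ/classM_hereditarily_small.
Qed.

(** Changing the operator by less than [e / 2] in norm changes [1_B S 1_B] by at most [e / 2 * mu B]
    for every [B], so a set found for a nearby member of M also serves for the limit. *)
Lemma classM_closed : closed (classM mu).
Proof.
move=> S clS; apply: scaled_classM => e A e0 Apos; have e2 : 0 < e / 2 by lra.
have [S' [MS' SS']] := clS _ (nbhsx_ballx S _ e2).
have {}SS' : `|S - S'| < e / 2 by move: SS'; rewrite -ball_normE.
have [B [Bpos BA Bfin h]] := classM_scaled MS' e2 Apos.
have [mB _] := Bpos; exists B; split => //.
have -> : S (L1indic mu B) = S' (L1indic mu B) + (S - S') (L1indic mu B).
  by rewrite -[(S - S') _]/(S _ - S' _) addrC subrK.
rewrite L1chi_mulD// (le_lt_trans (ler_normD _ _))//.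
have h2 : `|L1chi_mul B ((S - S') (L1indic mu B))| <= e / 2 * fine (mu B).
  rewrite (le_trans (L1chi_mul_norm _ mB))// (le_trans (bop_le _ _))//.
  by rewrite L1indic_norm// ler_wpM2r ?fine_ge0// ltW.
by lra.
Qed.

End Daugavet.

Theorem theorem1 (d : measure_display) (T : measurableType d) (R : realType)
    (mu : {measure set T -> \bar R})
    (mu_finite_subset : forall A : set T, Sigma_pos mu A ->
      exists B : set T, [/\ Sigma_pos mu B, B `<=` A & (mu B < +oo)%E]) :
  (forall N : set (Lop mu), submod_closed (mem N) ->
    (forall S : Lop mu, N S -> forall A : set T, Sigma_pos mu A ->
      `|Id_on mu A + op_on A S| = 1 + `|op_on A S|) ->
    N `<=` classM mu) /\
  [/\ submod_closed (mem (classM mu)),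
      closed (classM mu) &
      forall S : Lop mu, classM mu S -> forall A : set T, Sigma_pos mu A ->
        `|Id_on mu A + op_on A S| = 1 + `|op_on A S|].
Proof.
split=> [N [N0 Nlin] DN S NS|].
  apply: hereditarily_small_classM.
  apply: (Daugavet_hereditarily_small mu_finite_subset); first exact: DN.
  (* Linearity of [N] enters here: it contains [- S], so the equation holds for both signs. *)
  apply: DN; have := Nlin (-1) S 0.
  by rewrite !inE scaleN1r addr0; apply => //; move: N0; rewrite inE.
split.
- exact: classM_submod_closed.
- exact: classM_closed.
- exact: classM_Daugavet.
Qed.
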